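(* Let $V=\mathrm{Sym}(3,\mathbb{C})$ be the space of complex symmetric $3\times 3$ matrices, with $G=\mathrm{SL}(3,\mathbb{C})$ acting by $g\cdot x=gxg^t$, and let $A(2)=\mathbb{C}[V\oplus V]^G$ be the algebra of $G$-invariant polynomial functions of $(x,y)\in V\oplus V$, where $G$ acts diagonally. Then $A(2)$ is a polynomial algebra generated by the four (algebraically independent) polynomials $$\det x,\quad \det y,\quad f(x,x,y),\quad f(x,y,y).$$
   Context: $f$ denotes the symmetric trilinear form on $V$ obtained by full polarization of $\det$, normalized by $f(x,x,x)=6\det x$; equivalently $f(x,y,z)$ is the coefficient of $abc$ in $\det(ax+by+cz)$. *)

(* Defs.v *)
From HB Require Import structures.
From mathcomp Require Import all_boot all_order all_algebra.
From mathcomp Require Export reals complex mpoly.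

Set Implicit Arguments.
Unset Strict Implicit.
Unset Printing Implicit Defensive.

Import GRing.Theory.
Local Open Scope ring_scope.

Definition Sym (K : fieldType) (n : nat) : {vspace 'M[K]_n} :=
  fixedSpace (linfun (@trmx K n n)).

Lemma SymP (K : fieldType) (n : nat) (x : 'M[K]_n) :
  reflect (x^T = x) (x \in Sym K n).
Proof. by apply: (iffP fixedSpaceP); rewrite lfunE. Qed.

Notation symT K n := (subvs_of (Sym K n)).

(* g . x = g x g^T; vsproj only casts this (symmetric) matrix back to symT,   *)
(* see sym_actE.                                                              *)
Definition sym_act (K : fieldType) (n : nat) (g : 'M[K]_n) (x : symT K n) :
  symT K n := vsproj (Sym K n) (g *m vsval x *m g^T).

Lemma sym_actE (K : fieldType) (n : nat) (g : 'M[K]_n) (x : symT K n) :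
  vsval (sym_act g x) = g *m vsval x *m g^T.
Proof.
apply: vsprojK; apply/SymP.
by rewrite !trmx_mul trmxK (SymP _ (subvsP x)) mulmxA.
Qed.

(* Polynomial functions on a finite-dimensional space U: polynomials in the   *)
(* coordinates with respect to a basis of U. The basis chosen is irrelevant.  *)
Definition polynomial_function (K : fieldType) (U : vectType K)
    (F : U -> K) : Prop :=
  exists p : {mpoly K[\dim {:U}]},
    forall u : U, F u = p.@[fun i => coord (vbasis {:U}) i u].

(* Membership in K[V (+) V]^SL_n for V = Sym(n, K).                           *)
Definition invariant_pair (K : fieldType) (n : nat)
    (F : (symT K n * symT K n)%type -> K) : Prop :=
  polynomial_function F /\
  forall g : 'M[K]_n, \det g = 1 ->
    forall x y : symT K n, F (sym_act g x, sym_act g y) = F (x, y).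

Definition algebraically_independent (K : fieldType) (T : Type) (m : nat)
    (a : 'I_m -> T -> K) : Prop :=
  forall p : {mpoly K[m]}, (forall t : T, p.@[fun i => a i t] = 0) -> p = 0.

(* The set A of functions is exactly K[a_0, ..., a_(m-1)]; as p ranges over   *)
(* all polynomials this includes that the a_i belong to A.                    *)
Definition generated_by (K : fieldType) (T : Type) (A : (T -> K) -> Prop)
    (m : nat) (a : 'I_m -> T -> K) : Prop :=
  forall F : T -> K,
    A F <-> exists p : {mpoly K[m]}, forall t : T, F t = p.@[fun i => a i t].

(* The coefficient of abc in det(a x + b y + c z), where a, b, c are the      *)
(* indeterminates 'X_0, 'X_1, 'X_2.                                           *)
Definition pol_det (K : comNzRingType) (x y z : 'M[K]_3) : K :=
  (\det (\matrix_(i < 3, j < 3)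
      (x i j *: 'X_0 + y i j *: 'X_1 + z i j *: 'X_2 : {mpoly K[3]})))
  @_[multinom 1%N | _ < 3].

Definition four_invariants (K : fieldType) (i : 'I_4)
    (v : (symT K 3 * symT K 3)%type) : K :=
  let x := vsval v.1 in
  let y := vsval v.2 in
  [:: \det x; \det y; pol_det x x y; pol_det x y y]`_i.

(* Main.v *)
Require Import Defs.
From mathcomp Require Import all_boot all_order all_algebra.
From mathcomp Require Import reals complex mpoly.
From mathcomp Require Import ring.

(** The argument works over any [numClosedFieldType].  There is an affine
    4-space inside V (+) V, the slice, on which the four invariants are linear
    coordinates: the pencil

      s x + t y = [0, s, t; s, A, 0; t, 0, C]

    has determinant - s^2 C - t^2 A, so choosing the linear forms A and C
    suitably gives every binary cubic ([four_invariants_slice]).  Algebraic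
    independence follows at once, because a polynomial over an infinite field
    that vanishes at all points is zero ([mpoly_fun_eq0]).

    Let F be an invariant polynomial function and p the polynomial that F
    induces on the slice.  Then F = p(det x, det y, f(x,x,y), f(x,y,y)) at
    (x, y) as soon as (x, y) lies in the SL_3-orbit of the point of the slice
    with the same invariants.  This is the case when det x and the discriminant
    of the cubic det(s x + t y) are nonzero ([SL_congruent]): the pencil then
    has three distinct eigenvalues, which are determined by the invariants, and
    both pairs are congruent to (1, diag l) with l the triple of eigenvalues
    ([simultaneous_diagonalization]).  The resulting congruence between the two
    pairs has determinant 1 or -1, because it preserves det x, and since 3 is
    odd a change of sign makes it 1.  The two sides of the equality are
    polynomial functions, so their agreement where a nonzero polynomial function
    does not vanish is enough ([polynomial_function_dense]).

    Everything about f = [pol_det] is deduced from the inclusion-exclusion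
    formula [pol_detE], which shows that it is invariant and polynomial, and
    that with det x and det y it determines the cubic det(s x + t y)
    ([det_pencil]). *)

Set Implicit Arguments.
Unset Strict Implicit.
Unset Printing Implicit Defensive.

Import GRing.Theory Num.Theory.
Local Open Scope ring_scope.

(** * Polynomials vanishing as functions *)

Lemma meval_muni (K : comNzRingType) n (p : {mpoly K[n.+1]})
    (v : 'I_n.+1 -> K) :
  let v' i := v (widen_ord (leqnSn n) i) in
  p.@[v] = (map_poly (meval v') (muni p)).[v ord_max].
Proof.
move=> v'; rewrite mevalE muniE rmorph_sum /= horner_sum; apply: eq_bigr => m _.
rewrite map_polyZ hornerZ map_polyXn hornerXn /= mevalZ mevalX.
rewrite big_ord_recr mulrA /=; congr (_ * _ * _).
by apply: eq_bigr => i _; rewrite mnmE.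
Qed.

(** [muni] only regroups the monomials of p, so each coefficient of p can be
    read off from it. *)
Lemma muni_eq0 (K : comNzRingType) n (p : {mpoly K[n.+1]}) :
  muni p = 0 -> p = 0.
Proof.
move=> p0; apply/mpolyP => m; rewrite mcoeff0.
pose r (k : 'X_{1..n.+1}) := [multinom k (widen_ord (leqnSn n) i) | i < n].
have /(congr1 (fun q : {poly {mpoly K[n]}} => (q`_(m ord_max))@_(r m))) := p0.
rewrite coef0 mcoeff0 muniE coef_sum raddf_sum /=.
have coefm k : (p@_k *: 'X_[r k] *: 'X^(k ord_max))`_(m ord_max)@_(r m)
    = p@_k * (k == m)%:R.
  rewrite coefZ coefXn; have [->|nkm] := eqVneq k m.
    by rewrite eqxx mulr1 mcoeffZ mcoeffX eqxx.
  rewrite mulr0; case: eqVneq => [em|_]; last by rewrite mulr0 mcoeff0.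
  rewrite mulr1 mcoeffZ mcoeffX.
  case: eqP => [/mnmP ew|_]; last by rewrite mulr0.
  case/eqP: nkm; apply/mnmP => i.
  have [[j ->]|->] :
      (exists j, i = widen_ord (leqnSn n) j) \/ i = ord_max.
  - have [lin|gin] := ltnP i n.
      by left; exists (Ordinal lin); apply: val_inj.
    by right; apply/val_inj/eqP; rewrite eqn_leq gin -ltnS ltn_ord.
  - by have := ew j; rewrite !mnmE.
  - by rewrite em.
rewrite (eq_bigr _ (fun k _ => coefm k)).
have [mp|/memN_msupp_eq0 //] := boolP (m \in msupp p).
rewrite (bigD1_seq m) ?msupp_uniq //= eqxx mulr1 big1 ?addr0 // => k /negPf ->.
by rewrite mulr0.
Qed.

(** In characteristic 0 the naturals below the size of q would be too many
    roots. *)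
Lemma poly_fun_eq0 (K : numDomainType) (q : {poly K}) :
  (forall t, q.[t] = 0) -> q = 0.
Proof.
move=> q0; apply/eqP; apply: contraT => nzq.
have := @max_poly_roots _ q [seq i%:R | i <- iota 0 (size q)] nzq.
rewrite size_map size_iota ltnn; apply.
- by apply/allP => t _; rewrite rootE q0.
- by rewrite map_inj_uniq ?iota_uniq // => i j /eqP; rewrite eqr_nat => /eqP.
Qed.

(** By induction on the number of variables: fixing all variables but the last
    leaves a univariate polynomial without nonzero values, so its coefficients,
    which are polynomials in the other variables, vanish everywhere. *)
Lemma mpoly_fun_eq0 (K : numDomainType) n (p : {mpoly K[n]}) :
  (forall v, p.@[v] = 0) -> p = 0.
Proof.
elim: n p => [|n IHn] p p0.
  (* The only monomial in no variables is 1. *)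
  apply/mpolyP => m; rewrite mcoeff0; have em k : k = m by apply/mnmP => -[].
  have [mp|/memN_msupp_eq0 //] := boolP (m \in msupp p).
  have := p0 (fun=> 0); rewrite mevalE (bigD1_seq m) ?msupp_uniq //= big_ord0.
  by rewrite mulr1 big1 ?addr0 // => k; rewrite (em k) eqxx.
apply: muni_eq0; apply/polyP => k; rewrite coef0; apply: IHn => w.
rewrite -coef_map /= [map_poly _ _]poly_fun_eq0 ?coef0 // => t.
pose v (i : 'I_n.+1) := if insub (val i) is Some j then w j else t.
have ev : w =1 (fun i => v (widen_ord (leqnSn n) i)).
  move=> i; rewrite /v; case: insubP => [j _ /val_inj -> //|/=].
  by rewrite ltn_ord.
have vt : v ord_max = t by rewrite /v; case: insubP => //= j; rewrite ltnn.
rewrite -[RHS](p0 v) meval_muni vt; congr _.[_].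
by apply: eq_map_poly => q; apply: meval_eq.
Qed.

(** * The polarization of the determinant *)

Lemma mcoeff_X3 (K : nzRingType) (i j k : 'I_3) :
  ('X_i * 'X_j * 'X_k : {mpoly K[3]})@_[multinom 1%N | _ < 3]
    = (uniq [:: i; j; k])%:R.
Proof.
rewrite -!mpolyXD mcoeffX; congr (_%:R); congr nat_of_bool.
apply/eqP/idP => [/mnmP e|].
  move: (e i) (e j); rewrite !mnmE !eqxx /= !inE.
  rewrite (eq_sym j i) (eq_sym k i) (eq_sym k j).
  by case: (i == j); case: (i == k); case: (j == k).
move=> u; apply/mnmP => l; rewrite !mnmE.
by case: i j k l u
  => [[|[|[|?]]] ?] // [[|[|[|?]]] ?] // [[|[|[|?]]] ?] // [[|[|[|?]]] ?].
Qed.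

(** Inclusion-exclusion: the alternating sum of the values of a cubic form at
    the nonzero 0-1 vectors leaves the coefficient of the monomial that involves
    all three variables. *)
Lemma mcoeff_prod3 (K : comNzRingType) (a b c : 'I_3 -> K) :
  (\prod_i (a i *: 'X_0 + b i *: 'X_1 + c i *: 'X_2) : {mpoly K[3]})
     @_[multinom 1%N | _ < 3]
  = \prod_i (a i + b i + c i) - \prod_i (a i + b i) - \prod_i (a i + c i)
    - \prod_i (b i + c i) + \prod_i a i + \prod_i b i + \prod_i c i.
Proof.
pose M i (k : 'I_3) := [:: a i; b i; c i]`_(nat_of_ord k).
have lin i : a i *: 'X_0 + b i *: 'X_1 + c i *: 'X_2
    = \sum_(k < 3) M i k *: 'X_k :> {mpoly K[3]}.
  rewrite !big_ord_recl big_ord0 addr0 addrA /M /=.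
  by congr (_ + _ *: 'X__ + _ *: 'X__); apply: val_inj.
rewrite !big_ord_recl !big_ord0 /= !mulr1 mulrA !lin big_distrlr /=.
rewrite mulr_suml raddf_sum /=.
under eq_bigr => i _.
  rewrite mulr_suml raddf_sum /=.
  under eq_bigr => j _.
    rewrite mulr_sumr raddf_sum /=.
    under eq_bigr => k _.
      rewrite -!(scalerAl, scalerAr) !scalerA mcoeffZ mcoeff_X3.
      over.
    over.
  over.
rewrite !big_ord_recl !big_ord0 /M /=.
ring.
Qed.

(** The determinant is a signed sum of products of three entries, to each of
    which [mcoeff_prod3] applies. *)
Lemma pol_detE (K : comNzRingType) (x y z : 'M[K]_3) :
  pol_det x y z = \det (x + y + z) - \det (x + y) - \det (x + z)
    - \det (y + z) + \det x + \det y + \det z.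
Proof.
rewrite /pol_det /determinant raddf_sum /= -!sumrB -!big_split /=.
apply: eq_bigr => s _; rewrite -!mulrBr -!mulrDr.
have sgn (b : bool) (P : {mpoly K[3]}) m :
    ((-1) ^+ b * P)@_m = (-1) ^+ b * P@_m.
  by case: b; rewrite ?mulN1r ?mul1r ?mcoeffN.
rewrite sgn.
congr (_ * _); under eq_bigr do rewrite mxE.
rewrite mcoeff_prod3; repeat congr (_ + _); try congr (- _);
  by apply: eq_bigr => i _; rewrite !mxE.
Qed.

(** One term of the Leibniz expansion of [det_pencil]; the two brackets are the
    forms that [pol_detE] gives to f(x,x,y) and f(x,y,y). *)
Lemma prod3_pencil (K : comNzRingType) (a b : 'I_3 -> K) s t :
  2 * \prod_i (s * a i + t * b i) =
  2 * s ^+ 3 * \prod_i a i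
  + s ^+ 2 * t * (\prod_i (a i + a i + b i) - \prod_i (a i + a i)
      - 2 * \prod_i (a i + b i) + 2 * \prod_i a i + \prod_i b i)
  + s * t ^+ 2 * (\prod_i (a i + b i + b i) - 2 * \prod_i (a i + b i)
      - \prod_i (b i + b i) + \prod_i a i + 2 * \prod_i b i)
  + 2 * t ^+ 3 * \prod_i b i.
Proof.
rewrite !big_ord_recl !big_ord0 !mulr1.
set a0 := a _; set a1 := a _; set a2 := a _.
set b0 := b _; set b1 := b _; set b2 := b _.
move: a0 a1 a2 b0 b1 b2 => *; ring.
Qed.

(** The factor 2 avoids division: f(x,x,y) is twice the coefficient of s^2 t,
    because abc occurs in (a + b)^2 c with coefficient 2. *)
Lemma det_pencil (K : comNzRingType) (x y : 'M[K]_3) s t :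
  2 * \det (s *: x + t *: y) =
  2 * s ^+ 3 * \det x + s ^+ 2 * t * pol_det x x y + s * t ^+ 2 * pol_det x y y
  + 2 * t ^+ 3 * \det y.
Proof.
have prodD (A B : 'M[K]_3) (f : 'I_3 -> 'I_3) :
  \prod_i (A + B) i (f i) = \prod_i (A i (f i) + B i (f i)).
  by apply: eq_bigr => i _; rewrite mxE.
have prodDD (A B C : 'M[K]_3) (f : 'I_3 -> 'I_3) :
  \prod_i (A + B + C) i (f i) = \prod_i (A i (f i) + B i (f i) + C i (f i)).
  by apply: eq_bigr => i _; rewrite !mxE.
have prodP (f : 'I_3 -> 'I_3) : \prod_i (s *: x + t *: y) i (f i)
    = \prod_i (s * x i (f i) + t * y i (f i)).
  by apply: eq_bigr => i _; rewrite !mxE.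
rewrite !pol_detE /determinant -!sumrB -!big_split /= !mulr_sumr -!big_split /=.
apply: eq_bigr => u _; rewrite prodP !prodDD !prodD mulrCA prod3_pencil.
set e := (-1) ^+ _.
do ![set P := \prod_i _; move: P => P].
ring.
Qed.

Lemma det_mx3 (K : comNzRingType) (A : 'M[K]_3) :
  \det A = A 0 0 * (A 1 1 * A 2 2 - A 1 2 * A 2 1)
    - A 0 1 * (A 1 0 * A 2 2 - A 1 2 * A 2 0)
    + A 0 2 * (A 1 0 * A 2 1 - A 1 1 * A 2 0).
Proof.
rewrite (expand_det_row _ 0) !big_ord_recl big_ord0 /cofactor.
rewrite !(expand_det_row _ 0) !big_ord_recl !big_ord0 /cofactor !det_mx11 !mxE.
(* Indexing by naturals lets the lifted indices of the cofactors compute. *)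
pose a (i j : nat) := A (inord i) (inord j).
have Aa i j : A i j = a i j by rewrite /a !inord_val.
rewrite !{}Aa /= /bump /=.
by ring.
Qed.

Lemma det_congr (K : comNzRingType) n (g x : 'M[K]_n) :
  \det g = 1 -> \det (g *m x *m g^T) = \det x.
Proof. by move=> g1; rewrite !det_mulmx det_tr g1 mul1r mulr1. Qed.

Lemma pol_det_congr (K : comNzRingType) (g x y z : 'M[K]_3) : \det g = 1 ->
  pol_det (g *m x *m g^T) (g *m y *m g^T) (g *m z *m g^T) = pol_det x y z.
Proof.
by move=> g1; rewrite !pol_detE -!mulmxDl -!mulmxDr !det_congr.
Qed.

(** * Polynomial functions *)

Section PolynomialFunctions.

Variables (K : numFieldType) (U : vectType K).
Implicit Types F G : U -> K.

Lemma polynomial_function_ext F G :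
  F =1 G -> polynomial_function F -> polynomial_function G.
Proof. by move=> eFG [p Fp]; exists p => u; rewrite -eFG. Qed.

Lemma polynomial_function_comp m (a : 'I_m -> U -> K) (p : {mpoly K[m]}) :
  (forall i, polynomial_function (a i)) ->
  polynomial_function (fun u => p.@[fun i => a i u]).
Proof.
move=> /(fin_all_exists (P := fun i q => forall u, a i u = q.@[_])) [q aq].
exists (p \mPo [tuple q i | i < m]) => u; rewrite comp_mpoly_meval.
by apply: meval_eq => i; rewrite tnth_mktuple aq.
Qed.

Lemma polynomial_function_linear F :
  (forall a u v, F (a *: u + v) = a * F u + F v) -> polynomial_function F.
Proof.
move=> linF; have F0 : F 0 = 0.
  by have := linF (-1) 0 0; rewrite scaler0 addr0 mulN1r addNr.
exists (\sum_(i < \dim {:U}) F (vbasis {:U})`_i *: 'X_i) => u.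
rewrite {1}(coord_vbasis (memvf u)) raddf_sum /=.
apply: (big_rec2 (fun w s => F w = s)) => // i w s _ <-.
by rewrite linF mevalZ mevalXU mulrC.
Qed.

Lemma polynomial_functionC c : polynomial_function (fun _ : U => c).
Proof. by exists c%:MP => u; rewrite mevalC. Qed.

Lemma polynomial_functionD F G : polynomial_function F ->
  polynomial_function G -> polynomial_function (fun u => F u + G u).
Proof. by move=> [p Fp] [q Gq]; exists (p + q) => u; rewrite mevalD Fp Gq. Qed.

Lemma polynomial_functionM F G : polynomial_function F ->
  polynomial_function G -> polynomial_function (fun u => F u * G u).
Proof. by move=> [p Fp] [q Gq]; exists (p * q) => u; rewrite mevalM Fp Gq. Qed.

Lemma polynomial_functionN F : polynomial_function F ->
  polynomial_function (fun u => - F u).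
Proof. by move=> [p Fp]; exists (- p) => u; rewrite mevalN Fp. Qed.

Lemma polynomial_function_sum I (r : seq I) (F : I -> U -> K) :
  (forall i, polynomial_function (F i)) ->
  polynomial_function (fun u => \sum_(i <- r) F i u).
Proof.
move=> polF; elim: r => [|i r IHr].
  apply: polynomial_function_ext (polynomial_functionC 0) => u.
  by rewrite big_nil.
apply: polynomial_function_ext (polynomial_functionD (polF i) IHr) => u.
by rewrite big_cons.
Qed.

Lemma polynomial_function_prod I (r : seq I) (F : I -> U -> K) :
  (forall i, polynomial_function (F i)) ->
  polynomial_function (fun u => \prod_(i <- r) F i u).
Proof.
move=> polF; elim: r => [|i r IHr].
  apply: polynomial_function_ext (polynomial_functionC 1) => u.
  by rewrite big_nil.
apply: polynomial_function_ext (polynomial_functionM (polF i) IHr) => u.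
by rewrite big_cons.
Qed.

Lemma polynomial_function_det n (A : U -> 'M[K]_n) :
  (forall i j, polynomial_function (fun u => A u i j)) ->
  polynomial_function (fun u => \det (A u)).
Proof.
move=> polA; apply: polynomial_function_sum => s.
apply: polynomial_functionM; first exact: polynomial_functionC.
exact: polynomial_function_prod.
Qed.

(** The coordinates of a point of the affine space are polynomials of degree at
    most 1 in c. *)
Lemma polynomial_function_affine F m (u0 : U) (d : 'I_m -> U) :
  polynomial_function F ->
  exists p : {mpoly K[m]},
    forall c : 'I_m -> K, F (u0 + \sum_k c k *: d k) = p.@[c].
Proof.
move=> [q Fq]; pose e i := coord (vbasis {:U}) i.
exists (q \mPo [tuple (e i u0)%:MP + \sum_k e i (d k) *: 'X_k | i < \dim {:U}]).
move=> c; rewrite Fq comp_mpoly_meval; apply: meval_eq => i.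
rewrite tnth_mktuple mevalD mevalC !raddf_sum /= raddfD /=; congr (_ + _).
rewrite linear_sum; apply: eq_bigr => k _.
by rewrite linearZ mevalZ mevalXU mulrC.
Qed.

(** The product of F and G vanishes everywhere, hence is the zero polynomial,
    and polynomials over a field form an integral domain. *)
Lemma polynomial_function_dense F G u0 :
  polynomial_function F -> polynomial_function G -> G u0 != 0 ->
  (forall u, G u != 0 -> F u = 0) -> forall u, F u = 0.
Proof.
move=> [p Fp] [q Gq] nzG FG u.
have : p * q = 0.
  apply: mpoly_fun_eq0 => v.
  pose w := \sum_i v i *: (vbasis {:U})`_i.
  have vw : (fun i => coord (vbasis {:U}) i w) =1 v.
    by move=> i; rewrite coord_sum_free ?(basis_free (vbasisP _)).
  rewrite -(meval_eq _ vw) mevalM -Fp -Gq.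
  by have [->|/FG ->] := eqVneq (G w) 0; rewrite ?mulr0 ?mul0r.
move/eqP; rewrite mulf_eq0 => /orP[/eqP p0|/eqP q0].
  by rewrite Fp p0 meval0.
by rewrite Gq q0 meval0 eqxx in nzG.
Qed.

Definition polynomial_mx n (A : U -> 'M[K]_n) : Prop :=
  forall i j, polynomial_function (fun u => A u i j).

Lemma polynomial_mxD n (A B : U -> 'M[K]_n) :
  polynomial_mx A -> polynomial_mx B -> polynomial_mx (fun u => A u + B u).
Proof.
move=> polA polB i j.
apply: polynomial_function_ext
  (polynomial_functionD (polA i j) (polB i j)) => u.
by rewrite mxE.
Qed.

Lemma polynomial_pol_det (A B C : U -> 'M[K]_3) :
  polynomial_mx A -> polynomial_mx B -> polynomial_mx C ->
  polynomial_function (fun u => pol_det (A u) (B u) (C u)).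
Proof.
move=> polA polB polC.
have polAB := polynomial_mxD polA polB.
apply: polynomial_function_ext => [u|]; first by rewrite pol_detE.
do !apply: polynomial_functionD; try apply: polynomial_functionN;
  apply: polynomial_function_det => //; apply: polynomial_mxD => //.
Qed.

End PolynomialFunctions.

(** * Simultaneous diagonalization *)

(** A vanishing combination of the rows decomposes 0 in the direct sum of the
    eigenspaces, so each of its terms is 0. *)
Lemma eigenvectors_free (F : fieldType) m n (A : 'M[F]_n) (l : 'I_m -> F)
    (P : 'M[F]_(m, n)) :
  injective l -> (forall i, row i P != 0) ->
  (forall i, row i P *m A = l i *: row i P) -> row_free P.
Proof.
move=> injl nzP PA; apply: inj_row_free => u.
have dx : mxdirect (\sum_(i < m) eigenspace A (l i)).
  by apply: mxdirect_sum_eigenspace => i j _ _; apply: injl.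
have [C _ _ uC] := sub_dsumsmx dx (sub0mx _ _ : (0 : 'rV_n) <= _)%MS.
rewrite mulmx_sum_row => uP; apply/rowP => i; rewrite mxE.
have Cu : u 0 i *: row i P = C i.
  apply: (uC (fun j => u 0 j *: row j P) _ _ i isT) => // j _.
  by rewrite scalemx_sub //; apply/eigenspaceP.
have : 0 = C i.
  apply: (uC (fun=> 0) _ _ i isT); rewrite ?big1 // => j _; exact: sub0mx.
rewrite -{}Cu => /esym.
by move/eqP; rewrite scaler_eq0 (negPf (nzP i)) orbF => /eqP.
Qed.

(** The rows of P are vectors v_i with v_i y = l_i v_i x.  The Gram matrix
    E = P x P^T commutes with diag l, because P y P^T = diag l * E is symmetric.
    As the l_i are distinct, E is diagonal, and scaling the rows of P by inverse
    square roots of its diagonal entries turns it into the identity. *)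
Lemma simultaneous_diagonalization (K : numClosedFieldType) n (x y : 'M[K]_n)
    (l : 'I_n -> K) :
  x^T = x -> y^T = y -> x \in unitmx -> injective l ->
  (forall i, \det (y - l i *: x) = 0) ->
  exists2 g : 'M[K]_n, g *m x *m g^T = 1%:M &
    g *m y *m g^T = diag_mx (\row_i l i).
Proof.
move=> sx sy ux injl detl.
have /fin_all_exists2 [v nzv vl] i :
    exists2 v : 'rV[K]_n, v != 0 & v *m (y - l i *: x) = 0.
  by apply/det0P; rewrite detl.
pose P := \matrix_i v i; pose D := diag_mx (\row_i l i).
have vy i : v i *m y = l i *: (v i *m x).
  by apply/eqP; rewrite -subr_eq0 scalemxAr -mulmxBr vl.
have Py : P *m y = D *m (P *m x).
  apply/row_matrixP => i; rewrite row_mul rowK vy.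
  apply/rowP => j; rewrite mul_diag_mx !mxE; congr (_ * _).
  by apply: eq_bigr => k _; rewrite !mxE.
have uP : P \in unitmx.
  rewrite -row_free_unit.
  apply: (@eigenvectors_free _ _ _ (y *m invmx x) l) => // i; rewrite rowK //.
  by rewrite mulmxA vy -scalemxAl mulmxK.
pose E := P *m x *m P^T.
have symE : E^T = E by rewrite /E !trmx_mul trmxK sx mulmxA.
have PyP : P *m y *m P^T = D *m E by rewrite Py !mulmxA.
have DE : D *m E = E *m D.
  rewrite -[in RHS]symE -[D in RHS]tr_diag_mx -trmx_mul -PyP.
  by rewrite !trmx_mul trmxK sy mulmxA.
pose e := \row_i E i i.
have Ee : E = diag_mx e.
  apply/matrixP => i j; rewrite !mxE; have [->//|nij] := eqVneq i j.
  move/matrixP/(_ i j)/eqP: DE; rewrite mul_diag_mx mul_mx_diag !mxE mulrC.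
  rewrite -subr_eq0 -mulrBr mulf_eq0 subr_eq0 => /orP[/eqP -> //|/eqP/injl eij].
  by rewrite eij eqxx in nij.
have nze i : e 0 i != 0.
  have : E \in unitmx by rewrite !unitmx_mul unitmx_tr uP ux.
  rewrite unitmxE Ee det_diag unitfE; apply: contraNneq => e0.
  by rewrite (bigD1 i) //= e0 mul0r.
pose S := diag_mx (\row_i (sqrtC (e 0 i))^-1).
have SES : S *m E *m S = 1%:M.
  rewrite Ee !mulmx_diag; apply/matrixP => i j; rewrite !mxE.
  congr (_ *+ _); rewrite mulrAC -expr2 exprVn sqrtCK.
  by move: (nze i); rewrite !mxE; apply: mulVf.
exists (S *m P).
  by rewrite trmx_mul tr_diag_mx -SES /E !mulmxA.
rewrite trmx_mul tr_diag_mx -/S.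
have -> : S *m P *m y *m (P^T *m S) = S *m (P *m y *m P^T) *m S.
  by rewrite !mulmxA.
by rewrite PyP mulmxA [S *m D]diag_mxC -2!mulmxA (mulmxA S E) SES mulmx1.
Qed.

(** * Pencils with the same invariants *)

Definition cubic_disc (R : nzRingType) (a b c d : R) : R :=
  b ^+ 2 * c ^+ 2 - 4 * a * c ^+ 3 - 4 * b ^+ 3 * d + 18 * a * b * c * d
  - 27 * a ^+ 2 * d ^+ 2.

Lemma rmorph_cubic_disc (R S : nzRingType) (f : {rmorphism R -> S}) a b c d :
  f (cubic_disc a b c d) = cubic_disc (f a) (f b) (f c) (f d).
Proof.
by rewrite /cubic_disc !(rmorph_nat, rmorphXn, rmorphB, rmorphD, rmorphM).
Qed.

(** Over the closed field the cubic factors, and its discriminant is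
    a^4 ((l0 - l1) (l0 - l2) (l1 - l2))^2. *)
Lemma cubic_roots (K : numClosedFieldType) (a b c d : K) :
  a != 0 -> cubic_disc a b c d != 0 ->
  exists2 l : 'I_3 -> K, injective l &
    forall i, a * l i ^+ 3 + b * l i ^+ 2 + c * l i + d = 0.
Proof.
move=> nza nzD; pose p := Poly [:: d; c; b; a].
have pE : p = [:: d; c; b; a] :> seq K by rewrite (@PolyK _ 0).
have pt t : p.[t] = a * t ^+ 3 + b * t ^+ 2 + c * t + d.
  by rewrite horner_Poly /=; ring.
have [r] := closed_field_poly_normal p.
rewrite /lead_coef pE /= => pr.
have : size r = 3.
  have := congr1 (fun q : {poly K} => size q) pr.
  by rewrite size_scale // size_prod_XsubC pE => -[].
case: r pr => [|l0 [|l1 [|l2 [|? ?]]]] // pr _.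
have fact t : a * t ^+ 3 + b * t ^+ 2 + c * t + d
    = a * ((t - l0) * (t - l1) * (t - l2)).
  rewrite -pt pr !big_cons big_nil hornerZ !hornerM !hornerXsubC hornerC.
  by ring.
have nz2 : (2 : K) != 0 by rewrite pnatr_eq0.
(* The coefficients are recovered from the values at 0, 1 and -1. *)
have dE : d = - a * (l0 * l1 * l2).
  transitivity (a * 0 ^+ 3 + b * 0 ^+ 2 + c * 0 + d); first by ring.
  by rewrite fact; ring.
have bE : b = - a * (l0 + l1 + l2).
  apply: (mulfI nz2).
  transitivity ((a * 1 ^+ 3 + b * 1 ^+ 2 + c * 1 + d)
    + (a * (-1) ^+ 3 + b * (-1) ^+ 2 + c * (-1) + d) - 2 * d); first by ring.
  by rewrite !fact dE; ring.
have cE : c = a * (l0 * l1 + l0 * l2 + l1 * l2).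
  transitivity ((a * 1 ^+ 3 + b * 1 ^+ 2 + c * 1 + d) - a - b - d).
    by ring.
  by rewrite !fact dE bE; ring.
have D : cubic_disc a b c d = a ^+ 4 * ((l0 - l1) * (l0 - l2) * (l1 - l2)) ^+ 2.
  by rewrite /cubic_disc dE bE cE; ring.
move: nzD; rewrite D mulf_eq0 expf_eq0 /= (negPf nza) /= expf_eq0 /= !mulf_eq0.
rewrite !negb_or !subr_eq0 => /andP[/andP[n01 n02] n12].
exists (fun i : 'I_3 => [:: l0; l1; l2]`_i).
  move=> i j /eqP; rewrite nth_uniq ?ltn_ord //= => [/eqP/val_inj //|].
  by rewrite !inE negb_or n01 n02 n12.
move=> i; rewrite fact; case: i => [[|[|[|?]]] ?] //=; ring.
Qed.

(** The eigenvalues l_i are the roots of 2 det(y - l x), whose coefficients are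
    given by [det_pencil] at s = -l and t = 1; both pairs are congruent to
    (1, diag l). *)
Lemma SL_congruent (K : numClosedFieldType) (c : 'I_4 -> K)
    (x y x' y' : symT K 3) :
  (forall i, four_invariants i (x, y) = c i) ->
  (forall i, four_invariants i (x', y') = c i) ->
  c 0 != 0 -> cubic_disc (2 * c 0) (c 2) (c 3) (2 * c 1) != 0 ->
  exists g, [/\ \det g = 1, sym_act g x = x' & sym_act g y = y'].
Proof.
move=> cE cE' nzx nzD; have nz2 : (2 : K) != 0 by rewrite pnatr_eq0.
have [//||l injl lroot] := @cubic_roots _ (- (2 * c 0)) (c 2) (- c 3) (2 * c 1).
- by rewrite oppr_eq0 mulf_neq0.
(* The change of sign s = -l leaves the discriminant unchanged. *)
- by apply: contraNneq nzD => <-; apply/eqP; rewrite /cubic_disc; ring.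
have diag (u v : symT K 3) : (forall i, four_invariants i (u, v) = c i) ->
    exists2 g, g *m vsval u *m g^T = 1%:M &
      g *m vsval v *m g^T = diag_mx (\row_i l i).
  move=> uvE; apply: simultaneous_diagonalization => //.
  - by apply/SymP/subvsP.
  - by apply/SymP/subvsP.
  - by rewrite unitmxE unitfE (uvE 0 : \det (vsval u) = c 0).
  move=> i; apply: (mulfI nz2).
  have -> : vsval v - l i *: vsval u = (- l i) *: vsval u + 1 *: vsval v.
    by rewrite scale1r scaleNr addrC.
  rewrite det_pencil mulr0 -[RHS](lroot i).
  rewrite (uvE 0 : \det (vsval u) = c 0) (uvE 1 : \det (vsval v) = c 1).
  rewrite (uvE 2 : pol_det (vsval u) (vsval u) (vsval v) = c 2).
  rewrite (uvE 3 : pol_det (vsval u) (vsval v) (vsval v) = c 3).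
  ring.
have [g gx gy] := diag x y cE.
have [h hx hy] := diag x' y' cE'.
have uh : h \in unitmx.
  by have := unitmx1 K 3; rewrite -hx !unitmx_mul => /andP[/andP[]].
have uhT : h^T \in unitmx by rewrite unitmx_tr.
have [k kx ky] : exists2 k, k *m vsval x *m k^T = vsval x' &
    k *m vsval y *m k^T = vsval y'.
  have kE (u u' : symT K 3) : g *m vsval u *m g^T = h *m vsval u' *m h^T ->
      invmx h *m g *m vsval u *m (invmx h *m g)^T = vsval u'.
    move=> e; rewrite trmx_mul trmx_inv.
    transitivity (invmx h *m (g *m vsval u *m g^T) *m invmx h^T).
      by rewrite !mulmxA.
    by rewrite e !mulmxA mulVmx // mul1mx mulmxK.
  by exists (invmx h *m g); apply: kE; [rewrite gx hx | rewrite gy hy].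
have : \det k ^+ 2 = 1.
  apply: (mulIf nzx).
  rewrite mul1r -[in RHS](cE' 0 : \det (vsval x') = c 0) -kx !det_mulmx det_tr.
  by rewrite (cE 0 : \det (vsval x) = c 0) expr2 mulrAC.
move/eqP; rewrite sqrf_eq1 => /orP[] /eqP dk.
  by exists k; split=> //; apply: val_inj; rewrite /= sym_actE.
exists (- k); split.
- by rewrite -scaleN1r detZ dk; ring.
- apply: val_inj; rewrite /= sym_actE -kx raddfN /=.
  by rewrite mulNmx mulmxN mulNmx opprK.
- apply: val_inj; rewrite /= sym_actE -ky raddfN /=.
  by rewrite mulNmx mulmxN mulNmx opprK.
Qed.

(** * A slice on which the invariants are coordinates *)

Section Slice.

Variable K : numFieldType.
Notation V2 := (symT K 3 * symT K 3)%type.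

(** The slice consists of the pairs with pencil [0, s, t; s, A, 0; t, 0, C],
    where A = - (c_3/2 s + c_1 t) and C = - (c_0 s + c_2/2 t). *)
Definition slice_base : V2 :=
  (vsproj (Sym K 3) (delta_mx 0 1 + delta_mx 1 0),
   vsproj (Sym K 3) (delta_mx 0 2 + delta_mx 2 0)).

Definition slice_dir (k : 'I_4) : V2 :=
  let e i := vsproj (Sym K 3) (delta_mx i i) in
  [:: (- e 2, 0); (0, - e 1); (0, - 2^-1 *: e 2); (- 2^-1 *: e 1, 0)]`_k.

Definition slice (c : 'I_4 -> K) : V2 := slice_base + \sum_k c k *: slice_dir k.

Lemma vsval_slice c :
  vsval (slice c).1 = delta_mx 0 1 + delta_mx 1 0
    - c 0 *: delta_mx 2 2 - (2^-1 * c 3) *: delta_mx 1 1 /\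
  vsval (slice c).2 = delta_mx 0 2 + delta_mx 2 0
    - c 1 *: delta_mx 1 1 - (2^-1 * c 2) *: delta_mx 2 2.
Proof.
have symS i j : delta_mx i j + delta_mx j i \in Sym K 3.
  by apply/SymP; rewrite linearD /= !trmx_delta addrC.
have symD i : delta_mx i i \in Sym K 3 by apply/SymP; rewrite trmx_delta.
rewrite /slice /slice_base; move: (symS 0 1) (symS 0 2).
move: (delta_mx 0 1 + _) (delta_mx 0 2 + _) => A B symA symB.
(* Indexing by naturals lets the indices from the expanded sum compute. *)
pose c' k := c (inord k); have cE k : c k = c' (val k) by rewrite /c' inord_val.
rewrite !big_ord_recl big_ord0 /slice_dir /= !cE /=.
rewrite !(linearD, linearN, linearZ, linear0) /=.
rewrite (vsprojK symA) (vsprojK symB) !(vsprojK (symD _)).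
rewrite !scalerA !scalerN !add0r !addr0 !mulNr !scaleNr !addrA.
by split.
Qed.

Lemma four_invariants_slice c i : four_invariants i (slice c) = c i.
Proof.
rewrite /four_invariants; have [] := vsval_slice c.
move: (vsval (slice c).1) (vsval (slice c).2) => X Y eX eY.
have nz2 : (2 : K) != 0 by rewrite pnatr_eq0.
pose M a b : 'M[K]_3 := a *: X + b *: Y.
have detM a b : \det (M a b)
    = a ^+ 3 * c 0 + 2^-1 * a ^+ 2 * b * c 2 + 2^-1 * a * b ^+ 2 * c 3
      + b ^+ 3 * c 1.
  rewrite /M eX eY; move: (c 0) (c 1) (c 2) (c 3) => c0 c1 c2 c3.
  rewrite det_mx3 !mxE /= !(mulr0n, mulr1n).
  by field.
have addM a b a' b' : M a b + M a' b' = M (a + a') (b + b').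
  by rewrite /M !scalerDl addrACA.
have M1 : X = M 1 0 by rewrite /M scale1r scale0r addr0.
have M2 : Y = M 0 1 by rewrite /M scale1r scale0r add0r.
rewrite M1 M2 !pol_detE !addM !detM.
have c_ k : val i = val k -> c i = c k by move/val_inj->.
case: i c_ => [[|[|[|[|//]]]] ?] c_ /=.
- by rewrite (c_ 0) //; move: (c 0) (c 1) (c 2) (c 3) => c0 c1 c2 c3; field.
- by rewrite (c_ 1) //; move: (c 0) (c 1) (c 2) (c 3) => c0 c1 c2 c3; field.
- by rewrite (c_ 2) //; move: (c 0) (c 1) (c 2) (c 3) => c0 c1 c2 c3; field.
- by rewrite (c_ 3) //; move: (c 0) (c 1) (c 2) (c 3) => c0 c1 c2 c3; field.
Qed.

Lemma polynomial_four_invariants i :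
  polynomial_function (@four_invariants K i).
Proof.
have entry1 : polynomial_mx (fun u : V2 => vsval u.1).
  by move=> j k; apply: polynomial_function_linear => a u v; rewrite /= !mxE.
have entry2 : polynomial_mx (fun u : V2 => vsval u.2).
  by move=> j k; apply: polynomial_function_linear => a u v; rewrite /= !mxE.
case: i => [[|[|[|[|//]]]] ?].
- exact: (polynomial_function_det entry1).
- exact: (polynomial_function_det entry2).
- exact: (polynomial_pol_det entry1 entry1 entry2).
- exact: (polynomial_pol_det entry1 entry2 entry2).
Qed.

Lemma four_invariants_act i (g : 'M[K]_3) (x y : symT K 3) : \det g = 1 ->
  four_invariants i (sym_act g x, sym_act g y) = four_invariants i (x, y).
Proof.
move=> g1; rewrite /four_invariants /= !sym_actE.
by rewrite !pol_det_congr // !det_congr.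
Qed.

End Slice.

(** The equality is checked where det x and the discriminant do not vanish.
    Such points exist, since the slice contains one with cubic s^3 - s t^2. *)
Lemma invariant_eq_slice_polynomial (K : numClosedFieldType) F
    (p : {mpoly K[4]}) :
  invariant_pair F -> (forall c, F (slice c) = p.@[c]) ->
  forall u, F u = p.@[fun i => four_invariants i u].
Proof.
move=> [polF invF] Fslice u; apply/eqP; rewrite -subr_eq0; apply/eqP.
pose D : {mpoly K[4]} := 'X_0 * cubic_disc (2 *: 'X_0) 'X_2 'X_3 (2 *: 'X_1).
have DE c : D.@[c] = c 0 * cubic_disc (2 * c 0) (c 2) (c 3) (2 * c 1).
  by rewrite mevalM rmorph_cubic_disc /= !mevalZ !mevalXU.
move: u; apply: (@polynomial_function_dense _ _
  (fun u => F u - p.@[fun i => four_invariants i u])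
  (fun u => D.@[fun i => four_invariants i u])
  (slice (fun i => [:: 1; 0; 0; - 2]`_i))).
- apply: polynomial_functionD => //; apply: polynomial_functionN.
  exact/polynomial_function_comp/polynomial_four_invariants.
- exact/polynomial_function_comp/polynomial_four_invariants.
- rewrite (meval_eq _ (four_invariants_slice _)) DE /=.
  rewrite [X in X != 0](_ : _ = 64) ?pnatr_eq0 //.
  by rewrite /cubic_disc; ring.
case=> x y; rewrite DE mulf_eq0 negb_or => /andP[nz0 nzD].
pose c i := four_invariants i (x, y).
case Es: (slice c) (Fslice c) (four_invariants_slice c) => [x' y'] Fc cE.
have [g [g1 gx gy]] := @SL_congruent K c x y x' y' (fun=> erefl) cE nz0 nzD.
by rewrite -(invF g g1) gx gy Fc subrr.
Qed.

Lemma invariants_generated (K : numClosedFieldType) :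
  generated_by (@invariant_pair K 3) (@four_invariants K) /\
  algebraically_independent (@four_invariants K).
Proof.
split=> [F|p p0].
  split=> [invF|[p Fp]].
    have [p Fp] :=
      polynomial_function_affine (slice_base K) (@slice_dir K) invF.1.
    by exists p; apply: invariant_eq_slice_polynomial.
  split; last first.
    move=> g g1 x y; rewrite !Fp; apply: meval_eq => i.
    exact: four_invariants_act.
  apply: polynomial_function_ext (fun u => esym (Fp u)) _.
  exact/polynomial_function_comp/polynomial_four_invariants.
apply: mpoly_fun_eq0 => c.
by rewrite -(meval_eq _ (four_invariants_slice c)) p0.
Qed.

Theorem mainTheorem1 (R : realType) :
  generated_by (@invariant_pair R[i] 3) (@four_invariants R[i]) /\
  algebraically_independent (@four_invariants R[i]).
Proof. exact: invariants_generated. Qed.
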